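(* Let $\mathcal X$ be a linear space over the field $\mathbb K$ of real or complex numbers, and let $f,g\in\mathcal N(\mathcal X)\setminus\{O\}$ be two norms on $\mathcal X$. Then $f$ and $g$ are orderly independent if and only if they are totally non-equivalent.
   Context: $\mathcal N(\mathcal X)$ is the set of all norms on $\mathcal X$ together with the zero function $O$, with pointwise addition, $(\alpha f)(x)=|\alpha|f(x)$ for $\alpha\in\mathbb K$, and $f\le g$ iff $f(x)\le g(x)$ for all $x\in\mathcal X$; its set of minimal elements is $\{O\}$. For $f\in\mathcal N(\mathcal X)\setminus\{O\}$, $L(f):=\{g\in\mathcal N(\mathcal X):g\ge\alpha f\text{ for some }\alpha\in\mathbb K\setminus\{0\}\}$. Two elements $f,g\in\mathcal N(\mathcal X)\setminus\{O\}$ are orderly independent if neither $f\in L(g)$ nor $g\in L(f)$. Two norms on a linear space are totally non-equivalent if the topologies they induce are incomparable, i.e. neither topology is contained in the other. *)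

(* Defs.v *)
From HB Require Import structures.
From mathcomp Require Import all_boot all_order all_algebra.
From mathcomp Require Import complex.
From mathcomp Require Import all_classical all_reals all_analysis.

Set Implicit Arguments.
Unset Strict Implicit.
Unset Printing Implicit Defensive.

Import Order.TTheory GRing.Theory Num.Theory.

Local Open Scope classical_set_scope.
Local Open Scope ring_scope.

(* A theorem quantified over [k : scalar_kind] covers exactly the two cases
   of a real or a complex linear space. *)
Variant scalar_kind := RealScalars | ComplexScalars.

Definition scalars (R : realType) (k : scalar_kind) : numFieldType :=
  match k with
  | RealScalars => R
  | ComplexScalars => R[i]
  end.

(* The norm [`|z|] of [z : R[i]] provided by the library takes its values in
   [R[i]]; the modulus is [R]-valued in both cases, so that norms on complex
   linear spaces are [R]-valued as well. *)
Definition modulus (R : realType) (k : scalar_kind) : scalars R k -> R :=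
  match k return scalars R k -> R with
  | RealScalars => fun a : R => `|a|
  | ComplexScalars => fun z : R[i] => Normc.normc z
  end.

Arguments modulus {R k} _.

Lemma modulus_nat (R : realType) (k : scalar_kind) (n : nat) :
  modulus (n%:R : scalars R k) = n%:R.
Proof.
case: k => /=; first by rewrite normr_nat.
by have := @normcMn R 1 n; rewrite Normc.normc1.
Qed.

Lemma modulusN1 (R : realType) (k : scalar_kind) :
  modulus (-1 : scalars R k) = 1.
Proof.
case: k => /=; first by rewrite normrN1.
by have := @normcN R 1; rewrite Normc.normc1.
Qed.

Record norm_on (R : realType) (k : scalar_kind) (X : lmodType (scalars R k)) :=
  NormOn {
    norm_fun :> X -> R;
    norm_fun_ge0 : forall x, 0 <= norm_fun x;
    norm_fun_eq0 : forall x, norm_fun x = 0 <-> x = 0;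
    norm_funZ : forall (a : scalars R k) x,
      norm_fun (a *: x) = modulus a * norm_fun x;
    norm_funD : forall x y, norm_fun (x + y) <= norm_fun x + norm_fun y
  }.

(* [X] equipped with the norm [p], and with the topology induced by [p]. *)
Definition normed_by (R : realType) (k : scalar_kind)
  (X : lmodType (scalars R k)) (p : norm_on X) : Type := X.

Section NormedBy.
Context (R : realType) (k : scalar_kind) (X : lmodType (scalars R k)).
Variable p : norm_on X.

Let eq0 (x : normed_by p) : p x = 0 -> x = 0 :> X.
Proof. by move/norm_fun_eq0. Qed.

Let normMn (x : X) n : p (x *+ n) = p x *+ n.
Proof. by rewrite -scaler_nat norm_funZ modulus_nat mulr_natl. Qed.

Let normN (x : X) : p (- x) = p x.
Proof. by rewrite -scaleN1r norm_funZ modulusN1 mul1r. Qed.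

HB.instance Definition _ := GRing.Zmodule.copy (normed_by p) X.

HB.instance Definition _ := Num.Zmodule_isNormed.Build R (normed_by p)
  (@norm_funD _ _ _ p) eq0 normMn normN.

HB.instance Definition _ :=
  PseudoMetric.copy (normed_by p) (pseudoMetric_normed (normed_by p)).

HB.instance Definition _ := isPointed.Build (normed_by p) 0.

HB.instance Definition _ :=
  NormedZmod_PseudoMetric_eq.Build R (normed_by p) erefl.

End NormedBy.

Definition norm_topology (R : realType) (k : scalar_kind)
  (X : lmodType (scalars R k)) (p : norm_on X) : set (set X) :=
  [set U | open (U : set (normed_by p))].

Definition totally_non_equivalent (R : realType) (k : scalar_kind)
  (X : lmodType (scalars R k)) (p q : norm_on X) : Prop :=
  ~ (norm_topology p `<=` norm_topology q) /\
  ~ (norm_topology q `<=` norm_topology p).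

Section NormFunctions.
Context (R : realType) (k : scalar_kind) (X : lmodType (scalars R k)).
Implicit Types (f g : X -> R) (a : scalars R k).

Definition zero_fun : X -> R := fun=> 0.

Definition norm_functions : set (X -> R) :=
  [set f | (exists p : norm_on X, f = p :> (X -> R)) \/ f = zero_fun].

Definition norm_scale a f : X -> R := fun x => modulus a * f x.

Definition norm_le f g : Prop := forall x, f x <= g x.

Definition L f : set (X -> R) :=
  [set g | norm_functions g /\ exists2 a, a != 0 & norm_le (norm_scale a f) g].

Definition orderly_independent f g : Prop := ~ L g f /\ ~ L f g.

End NormFunctions.

Arguments zero_fun {R k} X _.
Arguments norm_functions {R k} X _.

(* Main.v *)
(** The norm [g] lies in [L f] exactly when the topology of [f] is contained in
    that of [g]: if the open unit ball of [f] contains the [g]-ball of radius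
    [r] around [0], then homogeneity gives [r f <= g], and conversely
    [c f <= g] puts the [g]-ball of radius [c r] inside the [f]-ball of
    radius [r]. *)

Require Import Defs.
From mathcomp Require Import all_boot all_order all_algebra.
From mathcomp Require Import complex.
From mathcomp Require Import all_classical all_reals all_analysis.

Import Order.TTheory GRing.Theory Num.Theory.

Local Open Scope classical_set_scope.
Local Open Scope ring_scope.

(** A nonnegative real, viewed as a scalar, is its own modulus; this lets real factors act on
    vectors of [X]. *)
Lemma modulus_surj (R : realType) (k : scalar_kind) (c : R) :
  0 <= c -> exists a : scalars R k, modulus a = c.
Proof.
by move=> c0; case: k => /=; [exists c; rewrite ger0_norm |
  exists c%:C%C; rewrite /= expr0n addr0 sqrtr_sqr ger0_norm].
Qed.

Lemma modulus0 (R : realType) (k : scalar_kind) :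
  modulus (0 : scalars R k) = 0.
Proof. exact: (@modulus_nat R k 0). Qed.

Lemma modulus_gt0 (R : realType) (k : scalar_kind) (a : scalars R k) :
  a != 0 -> 0 < modulus a.
Proof.
case: k a => /= a a0; first by rewrite normr_gt0.
rewrite lt0r; apply/andP; split; last by case: (a) => ? ?; exact: sqrtr_ge0.
by apply: contra_neq a0; exact: Normc.eq0_normc.
Qed.

Section NormTopology.
Context (R : realType) (k : scalar_kind) (X : lmodType (scalars R k)).
Implicit Types p q : norm_on X.

Lemma norm_fun0 p : p 0 = 0.
Proof. by apply/norm_fun_eq0. Qed.

Lemma norm_funN p x : p (- x) = p x.
Proof. by rewrite -[- x]scaleN1r norm_funZ modulusN1 mul1r. Qed.

(** Unfolding the topology into [p]-balls on the common carrier [X] makes the topologies of two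
    norms directly comparable. *)
Lemma norm_topologyP p (U : set X) :
  norm_topology p U <->
  forall x, U x -> exists2 r, 0 < r & forall y, p (x - y) < r -> U y.
Proof.
rewrite /norm_topology /= openE; split=> UP x Ux.
  by have /nbhs_ballP[r /= r0 rU] := UP x Ux; exists r => // y /rU.
by have [r r0 rU] := UP x Ux; apply/nbhs_ballP; exists r => //= y /rU.
Qed.

Lemma norm_topology_ball p : norm_topology p [set x | p x < 1].
Proof.
apply/norm_topologyP => x /= px1; exists (1 - p x); first by rewrite subr_gt0.
move=> y pxy; rewrite -(subrK x y); apply: le_lt_trans (norm_funD _ _ _) _.
by rewrite -opprB norm_funN -ltrBrDr.
Qed.

Lemma norm_topology_subP p q :
  norm_topology p `<=` norm_topology q <->
  exists2 c : R, 0 < c & forall x, c * p x <= q x.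
Proof.
split=> [pq|[c c0 cpq] U /norm_topologyP UP]; last first.
  apply/norm_topologyP => x /UP[r r0 rU].
  exists (c * r) => [|y qxy]; first exact: mulr_gt0.
  by apply: rU; rewrite -(ltr_pM2l c0); exact: le_lt_trans (cpq _) qxy.
have /norm_topologyP /(_ 0) /= [|r r0 rU] := pq _ (norm_topology_ball p).
  by rewrite norm_fun0.
exists r => // x; rewrite leNgt; apply/negP => qx.
(* The negated bound gives [0 <= q x < r * p x], so [x] can be normalised. *)
have px0 : 0 < p x.
  by rewrite -(pmulr_rgt0 _ r0); apply: le_lt_trans qx; exact: norm_fun_ge0.
have [a ap] : exists a : scalars R k, modulus a = (p x)^-1.
  by apply: modulus_surj; rewrite invr_ge0 ltW.
(* The vector [a *: x] has [p]-norm 1, outside the open unit ball, yet its [q]-norm [q x / p x] is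
   below [r]. The sign cancels the one in [0 - y]. *)
have := rU (- (a *: x)).
rewrite sub0r opprK /= norm_funN !norm_funZ ap.
by rewrite mulVf ?gt_eqF// ltxx mulrC ltr_pdivrMr// => /(_ qx).
Qed.

(** The modulus maps nonzero scalars onto the positive reals, so the scalar factor in [L] and the
    real factor [c] can be exchanged. *)
Lemma L_normP p q : L p q <-> norm_topology p `<=` norm_topology q.
Proof.
rewrite norm_topology_subP; split=> [[_ [a a0 apq]]|[c c0 cpq]].
  by exists (modulus a) => //; exact: modulus_gt0.
split; first by left; exists q.
have [a ac] := @modulus_surj R k c (ltW c0).
exists a; last by move=> x; rewrite /norm_scale ac.
by apply/eqP => a0; move: c0; rewrite -ac a0 modulus0 ltxx.
Qed.

End NormTopology.

Theorem mainTheorem8 (R : realType) (k : scalar_kind)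
    (X : lmodType (scalars R k)) (f g : norm_on X)
    (hf : (norm_functions X `\ zero_fun X) f)
    (hg : (norm_functions X `\ zero_fun X) g) :
  orderly_independent f g <-> totally_non_equivalent f g.
Proof.
(* After the rewriting, both sides are the same two non-inclusions in opposite order. *)
rewrite /orderly_independent /totally_non_equivalent !L_normP; tauto.
Qed.
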